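(* If $\mathfrak{b}<\mathfrak{b}(\mathcal{J},\mathcal{J},\mathcal{J})$ for some ideal $\mathcal{J}$ on $\omega$, then there is an ideal $\mathcal{I}$, which is not a weak P-ideal, such that $\mathfrak{b}(\mathcal{I},\mathrm{Fin},\mathrm{Fin})=\mathfrak{b}<\mathfrak{b}(\mathcal{I},\mathcal{I},\mathcal{I})$.
   Context: An ideal on a countable infinite set $X$ is a family $\mathcal{I}\subseteq\mathcal{P}(X)$ closed under finite unions and subsets, containing all finite subsets, with $X\notin\mathcal{I}$; $\mathrm{Fin}$ denotes the ideal of finite subsets of the relevant set. $\mathcal{I}$ is a weak P-ideal if for every countable $\mathcal{A}\subseteq\mathcal{I}$ there is $B\notin\mathcal{I}$ with $A\cap B$ finite for all $A\in\mathcal{A}$. $\mathfrak{b}$ is the bounding number. For an ideal $\mathcal{K}$ on $X$, $\widehat{\mathcal{P}}_{\mathcal{K}}$ is the family of sequences $\langle A_n:n\in\omega\rangle$ of pairwise disjoint members of $\mathcal{K}$, and $\mathcal{P}_{\mathcal{K}}$ those with union $X$. For ideals on $X$: $\mathfrak{b}(\mathcal{I},\mathcal{J},\mathcal{K})=\min\{|\mathcal{E}|:\mathcal{E}\subseteq\widehat{\mathcal{P}}_{\mathcal{K}},\ \forall\langle A_n\rangle\in\mathcal{P}_{\mathcal{J}}\ \exists\langle E_n\rangle\in\mathcal{E}\ \bigcup_n(A_n\cap\bigcup_{i\le n}E_i)\notin\mathcal{I}\}$, with $\min\emptyset=\mathfrak{c}^+$. *)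

(* Defs.v *)
From mathcomp Require Import all_boot all_classical.

Set Implicit Arguments.
Unset Strict Implicit.
Unset Printing Implicit Defensive.

Local Open Scope classical_set_scope.
Local Open Scope card_scope.

(** Cardinal numbers are represented by sets, compared by [#<=] and [#=]. *)

Definition card_lt T U (A : set T) (B : set U) : bool :=
  (A #<= B) && ~~ (B #<= A).

Reserved Notation "A '#<' B" (at level 79, format "A  '#<'  B").
Notation "A '#<' B" := (card_lt A B) : card_scope.

(* [mincard F] stands for min {|E| : E \in F}: it is a chosen member of [F] of
   least cardinality (see [mincardP]; the default [set0] is only used when [F]
   is empty). *)
Definition mincard T (F : set (set T)) : set T :=
  xget set0 [set E | F E /\ forall E', F E' -> E #<= E'].

Lemma mincardP T (F : set (set T)) : F !=set0 ->
  F (mincard F) /\ forall E, F E -> mincard F #<= E.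
Proof.
move=> [E0 FE0].
suff [E FE] : exists E, F E /\ forall E', F E' -> E #<= E' by exact: (@xgetI _ set0
  [set E | F E /\ forall E', F E' -> E #<= E'] E FE).
(* a maximal set of choice functions of F with injective coordinates *)
pose P (S : set (set T -> T)) :=
  (forall s E, S s -> F E -> E (s E)) /\
  (forall E, F E -> forall s t, S s -> S t -> s E = t E -> s = t).
have [S [[SF Sinj] Smax]] : exists S, P S /\ forall S', S `<` S' -> ~ P S'.
  apply: Zorn_bigcup => G GP Gtot; split=> [s E [X GX Xs]|E FE s t [X GX Xs] [Y GY Yt]].
    exact: (GP _ GX).1 s E Xs.
  have [XY|YX] := Gtot _ _ GX GY.
    by apply: (GP _ GY).2 => //; exact: XY.
  by apply: (GP _ GX).2 => //; exact: YX.
have Sle E : F E -> S #<= E.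
  move=> FE; have /card_esym/card_eqPle[Sle _] :
      (fun s => s E) @` S #= S.
    by apply: inj_card_eq => s t /set_mem Ss /set_mem St; exact: Sinj.
  apply: card_le_trans Sle _; apply: subset_card_le => _ [s Ss <-]; exact: (SF s E).
suff [E FE ES] : exists2 E, F E & E `<=` (fun s => s E) @` S.
  exists E; split=> // E' FE'; apply: card_le_trans (subset_card_le ES) _.
  exact: card_le_trans (card_image_le _ _) (Sle _ FE').
apply: contrapT => nES.
have new E : F E -> exists x, E x /\ forall s, S s -> s E <> x.
  move=> FE; apply: contrapT => nx; apply: nES; exists E => // x Ex.
  apply: contrapT => nSx; apply: nx; exists x; split=> // s Ss sE.
  by apply: nSx; exists s.
have [x0 _] := new _ FE0.
have /choice[s0 s0P] E : exists x, F E -> E x /\ forall s, S s -> s E <> x.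
  by have [/new[x ?]|nFE] := pselect (F E); [exists x|exists x0].
have Ss0 : ~ S s0 by move=> Ss0; exact: (s0P _ FE0).2 Ss0 erefl.
apply: (Smax (s0 |` S)).
  split=> [|sub]; first by move=> s Ss; right.
  by apply: Ss0; apply: sub; left.
split=> [s E [->|Ss] FE|E FE s t]; first exact: (s0P _ FE).1.
  exact: (SF s E).
move=> [->|Ss] [->|St] // st; last exact: Sinj st.
- by case: ((s0P _ FE).2 _ St).
- by case: ((s0P _ FE).2 _ Ss).
Qed.

Lemma card_le_total T U (A : set T) (B : set U) : (A #<= B) || (B #<= A).
Proof.
pose A' : set (T + U) := inl @` A; pose B' : set (T + U) := inr @` B.
have AA' : A' #= A by apply: inj_card_eq => x y _ _ [].
have BB' : B' #= B by apply: inj_card_eq => x y _ _ [].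
have [|mAB minAB] := @mincardP _ [set A'; B']; first by exists A'; left.
have {mAB minAB} : (A' #<= B') \/ (B' #<= A').
  by case: mAB minAB => -> minAB; [left|right]; apply: minAB; [right|left].
rewrite (card_le_eql AA') (card_le_eqr BB') (card_le_eql BB') (card_le_eqr AA').
by move=> /orP.
Qed.

Definition continuum : set (set nat) := [set: set nat].

(* The successor cardinal of [kappa], represented inside a type [U] that is
   assumed large enough to contain it (see [csuccP]). *)
Definition csucc U T (kappa : set T) : set U :=
  mincard [set C : set U | kappa #< C].
Arguments csucc U {T} kappa.

Lemma csuccP U T (kappa : set T) : kappa #< [set: U] ->
  kappa #< csucc U kappa /\
  forall V (C : set V), kappa #< C -> csucc U kappa #<= C.
Proof.
move=> kU; have [|kS minS] := @mincardP _ [set C : set U | kappa #< C].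
  by exists setT.
split=> // V C kC; have /orP[CU|UC] := card_le_total C [set: U]; last first.
  exact: card_le_trans (card_leT _) UC.
have /card_subP[C' /card_eqPle[C'C CC'] _] := CU.
apply: card_le_trans C'C; apply: minS; move: kC => /andP[kC nCk].
apply/andP; split; first exact: card_le_trans CC'.
by apply: contra nCk => /(card_le_trans CC').
Qed.

Lemma card_lt_powerset T : [set: T] #< [set: set T].
Proof.
apply/andP; split.
  have /card_esym/card_eqPle[Tle _] : set1 @` [set: T] #= [set: T].
    apply: inj_card_eq => x y _ _ xy.
    by have : [set x] x by []; rewrite xy.
  by apply: card_le_trans Tle _; apply: subset_card_le.
apply/negP => /card_leP[f].
pose g (A : set T) : T := val (f (SigSub (in_setT A))).
have ginj A B : g A = g B -> A = B.
  by move=> /val_inj fAB; have /(congr1 val) := 'inj_f (mem_set I) (mem_set I) fAB.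
pose D := [set x | exists2 A, g A = x & ~ A x].
have nD : ~ D (g D) by move=> D1; have [A /ginj -> ] := D1.
by apply: (nD); exists D.
Qed.

(** Ideals; they are only considered on countably infinite [X]. *)

Definition is_ideal X (I : set (set X)) : Prop :=
  [/\ forall A B, I A -> I B -> I (A `|` B),
      forall A B, A `<=` B -> I B -> I A,
      forall A, finite_set A -> I A
    & ~ I [set: X]].

Definition Fin X : set (set X) := [set A | finite_set A].
Arguments Fin : clear implicits.

Definition weak_P_ideal X (I : set (set X)) : Prop :=
  forall F : set (set X), countable F -> F `<=` I ->
    exists2 B, ~ I B & forall A, F A -> finite_set (A `&` B).

Definition eventually_le (f g : nat -> nat) : Prop :=
  finite_set [set n | ~~ (f n <= g n)].

Definition unbounded_families : set (set (nat -> nat)) :=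
  [set F | ~ exists g, forall f, F f -> eventually_le f g].

Lemma unbounded_families_neq0 : unbounded_families !=set0.
Proof.
exists setT => -[g /(_ (fun n => (g n).+1) I)]; rewrite /eventually_le.
rewrite (_ : [set n | _] = setT); first exact: infinite_nat.
by apply/seteqP; split=> // n _ /=; rewrite ltnn.
Qed.

Definition bounding : set (nat -> nat) := mincard unbounded_families.

Definition hatP X (K : set (set X)) : set (nat -> set X) :=
  [set A | (forall n, K (A n)) /\ trivIset setT A].

Definition partP X (K : set (set X)) : set (nat -> set X) :=
  [set A | hatP K A /\ \bigcup_n A n = setT].

Definition b_families X (I J K : set (set X)) : set (set (nat -> set X)) :=
  [set E | E `<=` hatP K /\
    forall A, partP J A -> exists2 e, E e &
      ~ I (\bigcup_n (A n `&` \bigcup_(i in [set i | (i <= n)%N]) e i))].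

(* Since [continuum]^+ need not embed in [nat -> set X], the cardinal lives in
   the powerset of that type; a family is sent there elementwise by
   [s |-> [set s]], which preserves its cardinality. *)
Definition bnum X (I J K : set (set X)) : set (set (nat -> set X)) :=
  if pselect (b_families I J K !=set0)
  then [set [set s] | s in mincard (b_families I J K)]
  else csucc (set (nat -> set X)) continuum.

Lemma continuum_lt_bnum_type X : [set: X] !=set0 ->
  continuum #< [set: set (nat -> set X)].
Proof.
move=> [x _]; have /andP[le nle] := card_lt_powerset (nat -> set X).
have cS : continuum #<= [set: nat -> set X].
  pose f (A : set nat) n : set X := [set _ | A n].
  have /card_esym/card_eqPle[cle _] : f @` continuum #= continuum.
    apply: inj_card_eq => A B _ _ fAB; apply/funext => n.
    exact: (congr1 (fun h : nat -> set X => h n x) fAB).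
  by apply: card_le_trans cle _; apply: subset_card_le.
apply/andP; split; first exact: card_le_trans le.
by apply: contra nle => /card_le_trans; apply.
Qed.

(* Main.v *)
Require Import Defs.
From mathcomp Require Import all_boot all_classical.

Set Implicit Arguments.
Unset Strict Implicit.
Unset Printing Implicit Defensive.

Local Open Scope classical_set_scope.
Local Open Scope card_scope.

(** The witness is the Fubini product [J (x) Fin] on [nat * nat]: the sets all
of whose columns, except [J]-few of them, are finite. The columns belong to it
and a set meeting every column in a finite set belongs to it, so it is not a
weak P-ideal. Against a partition of [nat * nat] into finite sets, one function
dominates the countably many functions that the partition induces on the
columns, so an unbounded family of functions defeats the partition on all
columns at once. Finally, a sequence [e] in [hatP (J (x) Fin)] is sent to the
sequence in [hatP J] whose [n]-th term collects the columns on which [e n] is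
the first infinite term; a partition of [nat] good for this sequence, lifted to
a partition of [nat * nat] into unions of columns, is good for [e]. *)

(** * Cardinal comparisons and the value of [bnum] *)

Lemma card_lt_le_trans T U V (A : set T) (B : set U) (C : set V) :
  A #< B -> B #<= C -> A #< C.
Proof.
move=> /andP[AB nBA] BC; apply/andP; split; first exact: card_le_trans BC.
by apply: contra nBA => /(card_le_trans BC).
Qed.

Lemma card_le_lt_trans T U V (A : set T) (B : set U) (C : set V) :
  A #<= B -> B #< C -> A #< C.
Proof.
move=> AB /andP[BC nCB]; apply/andP; split; first exact: card_le_trans BC.
by apply: contra nCB => CA; exact: card_le_trans AB.
Qed.

Lemma card_image_set1 T (A : set T) : [set [set x] | x in A] #= A.
Proof.
by apply: inj_card_eq => x y _ _ xy; have : [set x] x by []; rewrite xy.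
Qed.

Lemma bnum_card X (I J K : set (set X)) : b_families I J K !=set0 ->
  bnum I J K #= mincard (b_families I J K).
Proof.
move=> F0; rewrite /bnum; case: pselect => [?|/(_ F0)[]]; exact: card_image_set1.
Qed.

Lemma bnum_le X (I J K : set (set X)) E : b_families I J K E ->
  bnum I J K #<= E.
Proof.
move=> FE; have F0 : b_families I J K !=set0 by exists E.
by rewrite (card_le_eql (bnum_card F0)); exact: (mincardP F0).2.
Qed.

Lemma continuum_lt_bnum X (I J K : set (set X)) : [set: X] !=set0 ->
  ~ (b_families I J K !=set0) -> continuum #< bnum I J K.
Proof.
move=> X0; rewrite /bnum; case: pselect => // ? _.
exact: (csuccP (continuum_lt_bnum_type X0)).1.
Qed.

(** Needed when [b_families] is empty, so that [bnum] is the successor of [continuum]; a function is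
    coded by its graph. *)
Lemma bounding_le_continuum : bounding #<= continuum.
Proof.
pose graph (f : nat -> nat) : set nat := [set pickle (n, f n) | n in setT].
have /card_esym/card_eqPle[le _] : graph @` bounding #= bounding.
  apply: inj_card_eq => f g _ _ fg; apply/funext => n.
  have : graph f (pickle (n, f n)) by exists n.
  by rewrite fg => -[m _] /(pcan_inj pickleK)[-> ->].
exact: card_le_trans le (card_leT _).
Qed.

(** * Finite sets and disjointification *)

Lemma inj_finite_setP T (c : T -> nat) (A : set T) : injective c ->
  finite_set A <-> exists N, forall x, A x -> c x < N.
Proof.
move=> cinj; split=> [/(finite_image c)/finite_seqP[F cAF]|[N AN]].
  exists (\sum_(i <- F) i.+1) => x Ax.
  have xF : [set` F] (c x) by rewrite -cAF; exists x.
  by rewrite (big_rem _ xF) /= addSn ltnS leq_addr.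
have /card_eqPle[_ le] : c @` A #= A by apply: inj_card_eq => x y _ _ /cinj.
apply: card_le_finite le _; apply: sub_finite_set (finite_II N).
by move=> _ [x Ax <-]; exact: AN.
Qed.

Lemma finite_set_natP (A : set nat) :
  finite_set A <-> exists N, forall n, A n -> n < N.
Proof. exact: (@inj_finite_setP _ id). Qed.

Section Disjointification.
Context {T : Type}.
Implicit Type S : nat -> set T.

(** [hatP] demands disjoint terms, whereas [b_families] only looks at the initial unions of a
    sequence; this operation makes the terms disjoint and keeps those unions. *)
Definition first_part S n := S n `\` \bigcup_(i in `I_n) S i.

Lemma first_part_sub S n : first_part S n `<=` S n.
Proof. by move=> x []. Qed.

Lemma trivIset_first_part S : trivIset setT (first_part S).
Proof.
move=> i j _ _ [x [[Six nSi] [Sjx nSj]]].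
case: (ltngtP i j) => // ij; first by case: nSj; exists i.
by case: nSi; exists j.
Qed.

Lemma first_part_cover S n x : S n x ->
  (\bigcup_(i in [set i | i <= n]) first_part S i) x.
Proof.
elim/ltn_ind: n => n IH Snx.
have [[i /= lin Six]|nS] := pselect ((\bigcup_(i in `I_n) S i) x).
  have [j /= ji Sj] := IH i lin Six.
  by exists j => //=; exact: leq_trans ji (ltnW lin).
by exists n => //=.
Qed.

End Disjointification.

(* The union whose membership in the ideal decides [b_families]. *)
Local Notation crossing A e :=
  (\bigcup_n (A n `&` \bigcup_(i in [set i | (i <= n)%N]) e i)).

(** * The Fubini product as an ideal *)

Section FubiniFin.
Variable J : set (set nat).
Hypothesis J_ideal : is_ideal J.

Definition column (A : set (nat * nat)) k : set nat := [set m | A (k, m)].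

Definition infinite_columns (A : set (nat * nat)) : set nat :=
  [set k | infinite_set (column A k)].

Definition fubini_fin : set (set (nat * nat)) :=
  [set A | J (infinite_columns A)].

Let I := fubini_fin.

Let J_sub A B : A `<=` B -> J B -> J A.
Proof. by case: J_ideal => _ + _ _; exact. Qed.

Let J_fin A : finite_set A -> J A.
Proof. by case: J_ideal => _ _ + _; exact. Qed.

Lemma fubini_fin_finite_columns A :
  (forall k, finite_set (column A k)) -> I A.
Proof.
move=> Afin; apply: (J_sub (B := set0)); last exact: J_fin.
by move=> k; case.
Qed.

Lemma finite_column A k : finite_set A -> finite_set (column A k).
Proof.
move=> Afin; apply: sub_finite_set (finite_image snd Afin).
by move=> m Am; exists (k, m).
Qed.

Lemma fubini_fin_ideal : is_ideal I.
Proof.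
have [J_U _ _ JT] := J_ideal; split.
- move=> A B IA IB; apply: J_sub (J_U _ _ IA IB) => k /= nf.
  apply: contrapT => /not_orP[/contrapT fA /contrapT fB]; apply: nf.
  have -> : column (A `|` B) k = column A k `|` column B k by [].
  by rewrite finite_setU.
- move=> A B AB; apply: J_sub => k /= nf fB; apply: nf.
  by apply: sub_finite_set fB => m; exact: AB.
- by move=> A Afin; apply: fubini_fin_finite_columns => k; exact: finite_column.
- move=> IT; apply: JT; apply: J_sub IT => k _ /=; exact: infinite_nat.
Qed.

Lemma fubini_fin_not_weak_P : ~ weak_P_ideal I.
Proof.
pose col k : set (nat * nat) := [set x | x.1 = k].
move=> /(_ (range col)) [].
- exact: card_le_trans (card_image_le _ _) (countableP _).
- move=> _ [k _ <-]; apply: J_sub (J_fin (finite_set1 k)) => j /= nf.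
  apply: contrapT => jk; apply: nf; apply: sub_finite_set (@finite_set0 nat).
  by move=> m.
- move=> B nIB Bfin; apply: nIB; apply: fubini_fin_finite_columns => k.
  have : finite_set (col k `&` B) by apply: Bfin; exists k.
  move=> /(finite_column k); apply: sub_finite_set.
  by move=> m Bm; split.
Qed.

(** * The upper bound by the bounding number *)

Section Staircase.
Variable f : nat -> nat.

Definition staircase n : set (nat * nat) :=
  [set x | x.1 <= n /\ exists2 i, i <= n & x.2 <= f i].

Lemma finite_staircase n : finite_set (staircase n).
Proof.
apply: sub_finite_set (finite_setX (finite_II n.+1)
  (finite_II (\sum_(i < n.+1) f i).+1)) => -[k m] /= [kn [i lin mi]].
split; rewrite /= ltnS //; apply: leq_trans mi _.
by rewrite (bigD1 (Ordinal (lin : i < n.+1))) //= leq_addr.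
Qed.

End Staircase.

Lemma staircase_families F : unbounded_families F ->
  b_families I (Fin _) (Fin _) [set first_part (staircase f) | f in F].
Proof.
move=> Funb; split=> [_ [f Ff <-]|A [[Afin Adisj] AT]].
  split; last exact: trivIset_first_part.
  by move=> n; exact: sub_finite_set (@first_part_sub _ _ n) (finite_staircase f n).
(* [g (k, n)] is a height at which column [k] meets a term of index at least [n]: the first [n]
   terms are finite and cannot cover the column. *)
have /choice[g gP] (kn : nat * nat) :
    exists m, exists2 n', kn.2 <= n' & A n' (kn.1, m).
  case: kn => k n /=; apply: contrapT => nm; apply: infinite_nat.
  have : finite_set (\bigcup_(i in `I_n) A i).
    by apply: bigcup_finite => // i _; exact: Afin.
  move=> /(finite_column k); apply: sub_finite_set => m _.
  have [i _ Ai] : (\bigcup_n A n) (k, m) by rewrite AT.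
  exists i => //=; rewrite ltnNge; apply/negP => ni.
  by apply: nm; exists m, i.
(* The diagonal bound: from [n = k] on, [h] dominates [g (k, n)], for every [k] at once. *)
pose h n := \sum_(k < n.+1) g (k : nat, n).
have hg k n : k <= n -> g (k, n) <= h n.
  by move=> kn; rewrite /h (bigD1 (Ordinal (kn : k < n.+1))) //= leq_addr.
have [f Ff fh] : exists2 f, F f & ~ eventually_le f h.
  apply: contrapT => nf; apply: Funb; exists h => f Ff.
  by apply: contrapT => nfh; apply: nf; exists f.
exists (first_part (staircase f)); first by exists f.
set B := crossing _ _ => IB; have [_ _ _] := J_ideal; apply.
apply: J_sub IB => k _ /= Bfin; apply: fh; apply/finite_set_natP.
(* A finite column meets finitely many terms of [A], whereas the points
   [(k, g (k, n))] with [h n < f n] lie in terms of arbitrarily large index. *)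
have /finite_set_natP[N NP] :
    finite_set (\bigcup_(m in column B k) [set n | A n (k, m)]).
  apply: bigcup_finite => // m _.
  have [i _ Ai] : (\bigcup_n A n) (k, m) by rewrite AT.
  apply: sub_finite_set (finite_set1 i) => j Aj.
  by apply: Adisj => //; exists (k, m).
(* [N] handles [n >= k]; the summand [k] absorbs the [n < k], where [h n] need not bound
   [g (k, n)]. *)
exists (N + k) => n /=; rewrite -ltnNge => hf.
have [nk|kn] := ltnP n k; first exact: leq_trans nk (leq_addl _ _).
have [n' /= nn' An'] := gP (k, n).
apply: leq_trans (leq_addr _ _); apply: leq_ltn_trans (nn') (NP _ _).
exists (g (k, n)) => //; exists n' => //; split=> //.
apply: first_part_cover; split=> /=; first exact: leq_trans nn'.
by exists n => //; exact: leq_trans (hg _ _ kn) (ltnW hf).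
Qed.

Lemma bnum_fubini_fin_le : bnum I (Fin _) (Fin _) #<= bounding.
Proof.
have [bunb _] := mincardP unbounded_families_neq0.
apply: card_le_trans (bnum_le (staircase_families bunb)) _.
exact: card_image_le.
Qed.

Lemma fubini_fin_families_neq0 : b_families I (Fin _) (Fin _) !=set0.
Proof.
have [bunb _] := mincardP unbounded_families_neq0.
by eexists; exact: staircase_families bunb.
Qed.

(** * Comparison of the invariants of [J] and of its Fubini product *)

Definition column_seq (e : nat -> set (nat * nat)) : nat -> set nat :=
  first_part (infinite_columns \o e).

(** Lift a partition [B] to unions of columns. If [k] lies in [B n] and the lifted crossing is
    infinite on column [k], then some [e i] with [i <= n] is infinite there, which puts [k] in the
    crossing of [B] with [column_seq e]. So the latter crossing cannot be in [J]. *)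
Lemma column_seq_families E : b_families I I I E ->
  b_families J J J (column_seq @` E).
Proof.
move=> [EI Eb]; split=> [_ [e Ee <-]|B [[BJ Bdisj] BT]].
  split; last exact: trivIset_first_part.
  by move=> n; exact: J_sub (@first_part_sub _ _ n) ((EI _ Ee).1 n).
have [|e Ee nIe] := Eb (fun n => [set x | B n x.1]).
  split; [split|].
  - move=> n; apply: J_sub (BJ n) => k /= nf; apply: contrapT => nBk.
    by apply: nf; apply: sub_finite_set (@finite_set0 nat) => m.
  - by move=> i j _ _ [x [Bi Bj]]; apply: Bdisj => //; exists x.1.
  - apply/seteqP; split=> // -[k m] _.
    by have [n _ Bn] : (\bigcup_n B n) k; [rewrite BT|exists n].
exists (column_seq e); first by exists e.
apply: contra_not nIe; apply: J_sub => k /= nf.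
have [n _ Bn] : (\bigcup_n B n) k by rewrite BT.
exists n => //; split=> //; apply: contrapT => ne; apply: nf.
(* By disjointness only the term of index [n] of the lifted partition meets column [k]. *)
apply: (@sub_finite_set _ _ (\bigcup_(i in `I_n.+1) column (e i) k)).
  move=> m [n' _ [/= Bn' [i /= lin eim]]].
  have <- : n' = n by apply: Bdisj => //; exists k.
  by exists i.
apply: bigcup_finite => // i /= lin; apply: contrapT => nfi; apply: ne.
have [j /= ji Sj] : (\bigcup_(j in [set j | j <= i]) column_seq e j) k.
  exact: first_part_cover.
by exists j => //=; exact: leq_trans ji lin.
Qed.

Lemma bnum_le_fubini_fin : b_families I I I !=set0 ->
  bnum J J J #<= bnum I I I.
Proof.
move=> F0; rewrite (card_le_eqr (bnum_card F0)).
apply: card_le_trans (bnum_le (column_seq_families (mincardP F0).1)) _.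
exact: card_image_le.
Qed.

End FubiniFin.

(** * The lower bound by the bounding number *)

Section SpreadFunctions.
Context {X : Type} (c : X -> nat).
Hypothesis c_inj : injective c.

(** The finiteness assumption sits under the existential so that [spread_bound] is total and whole
    families can be mapped by it. *)
Lemma spread_bound_exists (e : nat -> set X) : exists f : nat -> nat,
  (forall n, finite_set (e n)) ->
  forall n i x, i <= n -> e i x -> c x < f n.
Proof.
have [efin|] := pselect (forall n, finite_set (e n)); last by exists id.
have /choice[f fP] n : exists N, forall x,
    (\bigcup_(i in `I_n.+1) e i) x -> c x < N.
  by apply/inj_finite_setP => //; exact: bigcup_finite.
by exists f => _ n i x lin eix; apply: fP; exists i.
Qed.

Definition spread_bound e := projT1 (cid (spread_bound_exists e)).

Lemma spread_boundP e n i x : (forall n, finite_set (e n)) -> i <= n ->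
  e i x -> c x < spread_bound e n.
Proof. by move=> ef; exact: (projT2 (cid (spread_bound_exists e))). Qed.

Variable g : nat -> nat.

(** For [n > 0] the rung of index [n] starts above [g n], hence misses [e 0], ..., [e n] as soon as
    [spread_bound e n <= g n]. *)
Fixpoint ladder n := if n is n'.+1 then ladder n' + (g n).+1 else 0.

Definition rungs n : set X := [set x | ladder n <= c x < ladder n.+1].

Lemma ladder_le : {homo ladder : m n / m <= n}.
Proof. by apply: homo_leq leqnn leq_trans _ => n /=; exact: leq_addr. Qed.

Lemma partP_rungs : partP (Fin X) rungs.
Proof.
split; [split|].
- move=> n; apply: (inj_finite_setP _ c_inj).2.
  by exists (ladder n.+1) => x /andP[].
- move=> i j _ _ [x [/andP[ix xi] /andP[jx xj]]].
  have lt_absurd m n : m < n -> c x < ladder m.+1 -> ladder n <= c x -> False.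
    move=> mn xm nx; have := leq_trans xm (leq_trans (ladder_le mn) nx).
    by rewrite ltnn.
  case: (ltngtP i j) => // ij; first by case: (lt_absurd _ _ ij xi jx).
  by case: (lt_absurd _ _ ij xj ix).
- apply/seteqP; split=> // x _.
  have : exists n, c x < ladder n.
    exists (c x).+1; elim: (c x) => [|n IH] //=.
    by rewrite addnS ltnS; exact: leq_trans IH (leq_addr _ _).
  move=> ex; case: (ex_minnP ex) => -[|n] // xn nmin.
  exists n => //; apply/andP; split=> //; rewrite leqNgt; apply/negP => /nmin.
  by rewrite ltnn.
Qed.

Lemma finite_crossing_rungs (e : nat -> set X) : hatP (Fin X) e ->
  eventually_le (spread_bound e) g -> finite_set (crossing rungs e).
Proof.
move=> [efin _] /finite_set_natP[N eN]; have [[rfin _] _] := partP_rungs.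
(* With [N.+1] the rungs to be excluded have positive index; rung [0] starts at [0] whatever [g]
   is. *)
apply: (@sub_finite_set _ _ (\bigcup_(n in `I_N.+1) rungs n)); last first.
  by apply: bigcup_finite => // i _; exact: rfin.
move=> x [n _ [rx [i /= lin eix]]]; exists n => //=; rewrite ltnNge.
apply/negP => Nn; have ex := spread_boundP efin lin eix.
have [/= fg|/eN] := boolP (spread_bound e n <= g n); last by rewrite ltnNge ltnW.
case: n => [//|n] in Nn rx lin ex fg *.
move: rx => /andP[/= nx _].
have gx : g n.+1 < c x := leq_trans (leq_addl _ _) nx.
by have := leq_trans (leq_trans ex fg) (ltnW gx); rewrite ltnn.
Qed.

End SpreadFunctions.

(** The spread bounds of a family of least size are unbounded: if [g] dominated them all, every
    crossing with the rungs of [g] would be finite, hence in [I]. *)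
Lemma bounding_le_bnum_Fin X (I : set (set X)) : countable [set: X] ->
  is_ideal I -> b_families I (Fin X) (Fin X) !=set0 ->
  bounding #<= bnum I (Fin X) (Fin X).
Proof.
move=> /countable_injP[c cinj] [_ _ Ifin _] F0.
have {}cinj : injective c by move=> x y; apply: cinj; rewrite in_setT.
have [[Mhat Mb] _] := mincardP F0.
rewrite (card_le_eqr (bnum_card F0)).
apply: card_le_trans (card_image_le (spread_bound cinj) _).
apply: (mincardP unbounded_families_neq0).2 => -[g gP].
have [e Me] := Mb _ (partP_rungs cinj g); apply; apply: Ifin.
apply: finite_crossing_rungs; first exact: Mhat.
by apply: gP; exists e.
Qed.

Theorem theorem8p7 (J : set (set nat)) (hJ : is_ideal J)
    (hb : bounding #< bnum J J J) :
  exists (X : Type) (I : set (set X)),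
    [/\ [set: X] #= [set: nat], is_ideal I, ~ weak_P_ideal I,
        bnum I (Fin X) (Fin X) #= bounding
      & bounding #< bnum I I I].
Proof.
exists (nat * nat)%type, (fubini_fin J); split.
- exact: card_nat2.
- exact: fubini_fin_ideal.
- exact: fubini_fin_not_weak_P.
- apply/card_eqPle; split; first exact: bnum_fubini_fin_le.
  apply: bounding_le_bnum_Fin; first exact: countableP.
    exact: fubini_fin_ideal.
  exact: fubini_fin_families_neq0.
- set I := fubini_fin J.
  have [F0|F0] := pselect (b_families I I I !=set0).
    exact: card_lt_le_trans hb (bnum_le_fubini_fin hJ F0).
  (* With no family at all, [bnum] takes its default value, the successor of [continuum]. *)
  apply: card_le_lt_trans bounding_le_continuum (continuum_lt_bnum _ F0).
  by exists (0, 0).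
Qed.
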